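(* Let $G$ be a $C_3$-free cactus graph. Then $\Gamma_{pr}(G)=2\Gamma(G)$ if and only if $G$ is isomorphic to $m_1K_2+m_2C_5$ for some nonnegative integers $m_1,m_2$ with $m_1+m_2\geq 1$.
   Context: All graphs are finite, simple and undirected. A set $D\subseteq V(G)$ is dominating if every vertex is in $D$ or adjacent to a vertex of $D$; it is minimal if no proper subset is dominating. $\Gamma(G)$ is the maximum cardinality of a minimal dominating set of $G$. A paired dominating set (PDS) is a dominating set $D$ such that $G[D]$ has a perfect matching; a PDS is minimal if no proper subset is a PDS. $\Gamma_{pr}(G)$ is the maximum cardinality of a minimal PDS. A cactus graph is a graph in which every edge lies on at most one cycle (the paper defines cactus graphs as connected, but here the statement is applied to graphs whose components are such). $C_3$-free means no triangle. $m_1K_2+m_2C_5$ denotes the disjoint union of $m_1$ copies of $K_2$ and $m_2$ copies of the 5-cycle $C_5$. *)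

(* Defs.v *)
From mathcomp Require Import all_boot.

Set Implicit Arguments.
Unset Strict Implicit.
Unset Printing Implicit Defensive.

Record sgraph := SGraph {
  vertex :> finType;
  adj : rel vertex;
  adj_sym : symmetric adj;
  adj_irrefl : irreflexive adj }.

Definition isomorphic (G H : sgraph) : Prop :=
  exists f : G -> H,
    bijective f /\ forall x y : G, adj (f x) (f y) = adj x y.

Section Domination.
Variable G : sgraph.
Implicit Types D : {set G}.

Definition dominating D : bool :=
  [forall x, (x \in D) || [exists y in D, adj x y]].

(* [minset p D] of finset.v: D satisfies p and no proper subset of D does. *)
Definition Gamma : nat := \max_(D : {set G} | minset dominating D) #|D|.

(* M is the edge set of a perfect matching of the subgraph induced by D. *)
Definition perfect_matching (M : {set {set G}}) D : bool :=
  partition M D &&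
  [forall e in M, exists x, exists y, adj x y && (e == [set x; y])].

Definition paired_dominating D : bool :=
  dominating D && [exists M, perfect_matching M D].

(* A graph with an isolated vertex has no paired dominating set; the maximum
   is then 0, whereas Gamma is positive on nonempty graphs. *)
Definition Gamma_pr : nat :=
  \max_(D : {set G} | minset paired_dominating D) #|D|.

(* The cyclic sequence of the vertices of a cycle of G. *)
Definition graph_cycle (c : seq G) : Prop := ucycle (@adj G) c /\ 2 < size c.

Definition cycle_edges (c : seq G) : {set {set G}} :=
  [set [set x; next c x] | x in c].

(* Several sequences describe the same cycle (rotations and reversals), so
   cycles are compared, as subgraphs, by their edge sets. Connectedness is not
   required: this says that every component of G is a connected cactus. *)
Definition cactus : Prop :=
  forall (x y : G) (c1 c2 : seq G), adj x y ->
    graph_cycle c1 -> [set x; y] \in cycle_edges c1 ->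
    graph_cycle c2 -> [set x; y] \in cycle_edges c2 ->
    cycle_edges c1 = cycle_edges c2.

Definition triangle_free : Prop :=
  ~ exists x y z : G, [/\ adj x y, adj y z & adj z x].

End Domination.

Section Complete.
Variable n : nat.

Definition complete_rel : rel 'I_n := fun i j => i != j.

Lemma complete_rel_sym : symmetric complete_rel.
Proof. by move=> i j; rewrite /complete_rel eq_sym. Qed.

Lemma complete_rel_irrefl : irreflexive complete_rel.
Proof. by move=> i; rewrite /complete_rel eqxx. Qed.

Definition complete_graph := SGraph complete_rel_sym complete_rel_irrefl.

End Complete.

Section Cycle.
Variable n : nat.

(* ordS is the successor modulo n; the test i != j only matters for n = 1. *)
Definition cycle_rel : rel 'I_n :=
  fun i j => (i != j) && ((j == ordS i) || (i == ordS j)).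

Lemma cycle_rel_sym : symmetric cycle_rel.
Proof. by move=> i j; rewrite /cycle_rel eq_sym orbC. Qed.

Lemma cycle_rel_irrefl : irreflexive cycle_rel.
Proof. by move=> i; rewrite /cycle_rel eqxx. Qed.

Definition cycle_graph := SGraph cycle_rel_sym cycle_rel_irrefl.

End Cycle.

Section Copies.
Variables (m : nat) (G : sgraph).

Definition copies_rel : rel ('I_m * G)%type :=
  fun u v => (u.1 == v.1) && adj u.2 v.2.

Lemma copies_rel_sym : symmetric copies_rel.
Proof. by move=> u v; rewrite /copies_rel eq_sym adj_sym. Qed.

Lemma copies_rel_irrefl : irreflexive copies_rel.
Proof. by move=> u; rewrite /copies_rel adj_irrefl andbF. Qed.

Definition copies := SGraph copies_rel_sym copies_rel_irrefl.

End Copies.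

Section DisjointUnion.
Variables G H : sgraph.

Definition union_rel : rel (G + H)%type := fun u v =>
  match u, v with
  | inl x, inl y => adj x y
  | inr x, inr y => adj x y
  | _, _ => false
  end.

Lemma union_rel_sym : symmetric union_rel.
Proof. by case=> x [] y //=; rewrite adj_sym. Qed.

Lemma union_rel_irrefl : irreflexive union_rel.
Proof. by case=> x /=; rewrite adj_irrefl. Qed.

Definition disjoint_union := SGraph union_rel_sym union_rel_irrefl.

End DisjointUnion.

(* Main.v *)
Require Import Defs.
From mathcomp Require Import all_boot zify.

Set Implicit Arguments.
Unset Strict Implicit.
Unset Printing Implicit Defensive.

(* Let D be a minimal paired dominating set with 2 Gamma vertices, matched by
   mu, and recall that independent sets have at most Gamma vertices. By
   minimality every matching edge of D either has an end that is a leaf of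
   G[D] or has a private neighbour outside D. The edges of the second kind
   together with their private neighbours span a triangle-free cactus, in which
   some independent set has more than a third of the vertices; adding one leaf
   per edge of the first kind would give more than Gamma independent vertices.
   So there is a set X of leaves, one per matching edge. For o outside D,
   replace the neighbours of o in X by their mates and add o: the result is too
   large to be independent, so o closes a 5-cycle with two matching edges. In a
   cactus these 5-cycles are disjoint and have no further edges into D, and an
   edge between two of them would yield a minimal dominating set with
   Gamma + 1 vertices. *)

(** * Domination, independence and matchings as involutions *)

Definition independent (G : sgraph) (I : {set G}) : bool :=
  [forall x in I, forall y in I, ~~ adj x y].

Definition dominates (G : sgraph) (x y : G) : bool := (x == y) || adj x y.

(* A perfect matching of G[D], as the involution exchanging matched vertices. *)
Definition matching_on (G : sgraph) (mu : G -> G) (D : {set G}) : Prop :=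
  {in D, forall x, [/\ mu x \in D, adj x (mu x) & mu (mu x) = x]}.

Section Basics.
Variable G : sgraph.
Implicit Types (D B I : {set G}) (x y z : G).

Lemma independentP I :
  reflect {in I &, forall x y, ~~ adj x y} (independent I).
Proof.
apply: (iffP forall_inP) => [H x y xI yI | H x xI].
  exact: (forall_inP (H x xI)).
by apply/forall_inP => y yI; apply: H.
Qed.

Lemma adj_neq x y : adj x y -> x != y.
Proof. by apply: contraTneq => ->; rewrite adj_irrefl. Qed.

Lemma dominatesC x y : dominates x y = dominates y x.
Proof. by rewrite /dominates eq_sym adj_sym. Qed.

Lemma dominatingP D :
  reflect (forall x, exists2 y, y \in D & dominates x y) (dominating D).
Proof.
apply: (iffP forallP) => H x; have := H x.
  case/orP => [xD | /exists_inP[y yD xy]]; first by exists x => //; rewrite /dominates eqxx.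
  by exists y => //; rewrite /dominates xy orbT.
case=> y yD /orP[/eqP -> | xy]; first by rewrite yD.
by apply/orP; right; apply/exists_inP; exists y.
Qed.

Lemma not_dominating_exists D :
  ~~ dominating D -> exists p, {in D, forall y, ~~ dominates p y}.
Proof.
case/forallPn => p; rewrite negb_or => /andP[pD /exists_inPn H].
exists p => y yD; rewrite negb_or H // andbT.
by apply: contraNneq pD => ->.
Qed.

Lemma minimal_dominating_private D x :
  minset (@dominating G) D -> x \in D ->
  exists2 p, dominates p x & {in D, forall y, dominates p y -> y = x}.
Proof.
case/minsetP => domD minD xD.
have /not_dominating_exists[p Hp] : ~~ dominating (D :\ x).
  apply/negP => /minD => /(_ (subsetDl _ _)) /setP/(_ x).
  by rewrite !inE xD eqxx.
have Hpx y : y \in D -> dominates p y -> y = x.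
  move=> yD py; apply/eqP; apply: contraTT py => yx.
  by apply: Hp; rewrite !inE yx.
exists p => //; have [y yD py] := dominatingP _ domD p.
by rewrite -(Hpx y).
Qed.

(** The vertex [p] attached to [x] is left undominated once [x] is removed, so [D] is minimal. *)
Lemma irredundant_dominating_card D :
  dominating D ->
  {in D, forall x, exists2 p, dominates p x
                          & {in D, forall y, dominates p y -> y = x}} ->
  #|D| <= Gamma G.
Proof.
move=> domD privD; apply: (leq_bigmax_cond (F := fun D : {set G} => #|D|)).
apply/minsetP; split=> // B /dominatingP domB BD.
apply/eqP; rewrite eqEsubset BD; apply/subsetP => x /privD[p px Hp].
have [y yB py] := domB p.
by rewrite -(Hp y) ?(subsetP BD).
Qed.

(** A maximal independent superset of [I] is dominating, and each of its vertices is its own private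
    neighbour. *)
Lemma independent_card_Gamma I : independent I -> #|I| <= Gamma G.
Proof.
case/maxset_exists => J /maxsetP[/independentP indJ maxJ] /subset_leq_card IJ.
apply: leq_trans IJ (irredundant_dominating_card _ _); last first.
  move=> x xJ; exists x; first by rewrite /dominates eqxx.
  by move=> y yJ /orP[/eqP // | xy]; have := indJ _ _ xJ yJ; rewrite xy.
apply/forallP => x; case: (boolP (x \in J)) => //= xJ.
apply/negbNE/negP => /exists_inPn Hx.
suff /maxJ/(_ (subsetUr _ _))/setP/(_ x) : independent (x |: J).
  by rewrite !inE eqxx (negbTE xJ).
apply/independentP => y z /setU1P[-> | yJ] /setU1P[-> | zJ].
- by rewrite adj_irrefl.
- exact: Hx.
- by rewrite adj_sym Hx.
- exact: indJ.
Qed.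

Lemma paired_dominatingP D :
  reflect (dominating D /\ exists mu, matching_on mu D) (paired_dominating D).
Proof.
apply: (iffP andP) => [[domD /existsP[M /andP[partM /forall_inP HM]]] | ].
  split=> //; have [/eqP covM triM _] := and3P partM.
  (* [mu x] is the partner of [x] in its edge of [M]; the default [x] is taken only outside [D],
     where [matching_on] demands nothing. *)
  exists (fun x => odflt x [pick y | [set x; y] \in M]) => x xD.
  have MD a b : [set a; b] \in M -> [/\ a \in D, b \in D & adj a b].
    move=> abM; rewrite -covM; split.
    - by apply/bigcupP; exists [set a; b] => //; rewrite set21.
    - by apply/bigcupP; exists [set a; b] => //; rewrite set22.
    have /existsP[u /existsP[v /andP[uv /eqP E]]] := HM _ abM.
    have := set21 u v; have := set22 u v; rewrite -E.
    move=> /set2P[] vE /set2P[] uE; subst; rewrite ?adj_irrefl in uv => //.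
    by rewrite adj_sym.
  have uniqM a b c : [set a; b] \in M -> [set a; c] \in M -> b = c.
    move=> abM acM; have [_ _ ab] := MD _ _ abM.
    have E : [set a; b] = [set a; c].
      by rewrite -(def_pblock triM abM (set21 a b)) (def_pblock triM acM (set21 a c)).
    have := set22 a b; rewrite E => /set2P[] // ba.
    by rewrite ba adj_irrefl in ab.
  have [y xyM] : exists y, [set x; y] \in M.
    have xc : x \in cover M by rewrite covM.
    have PM := pblock_mem xc; have := xc; rewrite -mem_pblock.
    have /existsP[u /existsP[v /andP[uv /eqP E]]] := HM _ PM.
    rewrite E in PM *; case/set2P => ->; first by exists v.
    by exists u; rewrite setUC.
  have pickM a b : [set a; b] \in M -> odflt a [pick y | [set a; y] \in M] = b.
    by move=> abM; case: pickP => [c acM | /(_ b)]; [apply: uniqM acM abM | rewrite abM].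
  rewrite (pickM x y) // (pickM y x); last by rewrite setUC.
  by case: (MD _ _ xyM).
case=> domD [mu Hmu]; split=> //; apply/existsP.
exists [set [set x; mu x] | x in D]; apply/andP; split; last first.
  apply/forall_inP => e /imsetP[x xD ->]; apply/existsP; exists x.
  by apply/existsP; exists (mu x); have [_ -> _] := Hmu x xD; rewrite eqxx.
apply/and3P; split.
- rewrite cover_imset; apply/eqP/setP => x; apply/bigcupP/idP.
    by case=> y yD /set2P[] -> //; have [] := Hmu y yD.
  by move=> xD; exists x => //; rewrite set21.
- apply/trivIsetP => _ _ /imsetP[x xD ->] /imsetP[y yD ->].
  apply: contraNT => /pred0Pn[z /andP[]] /=.
  have [_ _ mx] := Hmu x xD; have [_ _ my] := Hmu y yD.
  case/set2P => -> /set2P[] E.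
  + by rewrite E.
  + by rewrite E my setUC.
  + by rewrite -E mx setUC.
  + by rewrite -mx E my.
- apply/negP => /imsetP[x _] /setP/(_ x).
  by rewrite !inE eqxx.
Qed.

(** The form in which minimality is applied: a smaller set that is still matched can only fail by
    leaving some vertex undominated. *)
Lemma minimal_paired_dominating_sub D B mu :
  minset (@paired_dominating G) D -> B \proper D -> matching_on mu B ->
  exists p, {in B, forall y, ~~ dominates p y}.
Proof.
case/minsetP => pdD minD /andP[BD DB] muB; apply: not_dominating_exists.
apply: contra DB => domB; rewrite (minD B) //.
by apply/paired_dominatingP; split=> //; exists mu.
Qed.

End Basics.

(** * Large independent sets in triangle-free cacti *)

Section Cactus.
Variable G : sgraph.
Hypothesis G_cactus : cactus G.
Implicit Types (S I : {set G}) (x y z : G).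

(** Both cycles use the edge [xy], so they have the same edges and therefore the same vertices. *)
Lemma cactus_cycle_mem x y s1 s2 z :
  graph_cycle (x :: y :: s1) -> graph_cycle (x :: y :: s2) ->
  z \in x :: y :: s2 -> z \in x :: y :: s1.
Proof.
move=> c1 c2 zc2.
have xyc s : [set x; y] \in cycle_edges (x :: y :: s).
  by apply/imsetP; exists x; rewrite ?mem_head //= eqxx.
have xy : adj x y by case: c1 => /andP[/= /andP[]].
have : [set z; next (x :: y :: s2) z] \in cycle_edges (x :: y :: s2).
  exact: imset_f.
rewrite -(G_cactus xy c1 (xyc _) c2 (xyc _)) => /imsetP[w wc1 E].
by have := set21 z (next (x :: y :: s2) z); rewrite E => /set2P[] ->;
  rewrite ?mem_next.
Qed.

(** The chords from [z1] and [z2] back to [x] close two cycles through the edge [xy], and the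
    shorter one misses [z2]. *)
Lemma cactus_no_two_chords x y z1 z2 p1 p2 p3 :
  path (@adj G) x (y :: p1 ++ z1 :: p2 ++ z2 :: p3) ->
  uniq (x :: y :: p1 ++ z1 :: p2 ++ z2 :: p3) ->
  adj z1 x -> adj z2 x -> False.
Proof.
move=> pth unq z1x z2x.
have c1 : graph_cycle (x :: y :: rcons p1 z1).
  split; last by rewrite /= size_rcons.
  apply/andP; split.
    move: pth; rewrite /= cat_path /= rcons_path last_rcons z1x andbT rcons_path.
    by case/and4P => -> -> ->.
  by move: unq; rewrite -cat_rcons -2!cat_cons cat_uniq => /and3P[].
have c2 : graph_cycle (x :: y :: p1 ++ z1 :: rcons p2 z2).
  split; last by rewrite /= size_cat /= size_rcons; lia.
  apply/andP; split.
    move: pth; rewrite /= rcons_path cat_path /= cat_path /= last_cat /= last_rcons z2x andbT.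
    rewrite cat_path /= rcons_path.
    by case/and5P => -> -> -> -> /andP[-> _].
  have E : x :: y :: p1 ++ z1 :: p2 ++ z2 :: p3
           = (x :: y :: p1 ++ z1 :: rcons p2 z2) ++ p3.
    by rewrite /= -catA /= cat_rcons.
  by move: unq; rewrite E cat_uniq => /and3P[].
have := cactus_cycle_mem (z := z2) c1 c2.
rewrite !inE mem_cat inE mem_rcons mem_head !orbT => /(_ isT) z2c1.
move: unq; rewrite -cat_rcons -2!cat_cons cat_uniq => /and3P[_ /hasPn/(_ z2)].
by rewrite mem_cat mem_head orbT => /(_ isT); rewrite inE z2c1.
Qed.

(* The first vertex of a path that cannot be prolonged has all its neighbours
   on the path; three of them would give two cycles through the first edge. *)
Lemma cactus_degree_le2 S :
  S != set0 -> exists2 x, x \in S & #|[set y in S | adj x y]| <= 2.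
Proof.
case/set0Pn => x0 x0S.
(* The path is prolonged at its front; [n] exceeds the number of vertices off the path, so this
   ends. *)
suff H n x p : #|G| - size (x :: p) < n -> path (@adj G) x p -> uniq (x :: p) ->
    {subset x :: p <= S} -> exists2 x, x \in S & #|[set y in S | adj x y]| <= 2.
  by apply: (H _ x0 [::] (leqnn _)) => // z; rewrite inE => /eqP ->.
elim: n x p => // n IH x p szp pth unq sub.
set N := [set y in S | adj x y].
have [deg | deg] := leqP #|N| 2; first by exists x => //; apply/sub/mem_head.
have [/subsetP Np | /subsetPn[y]] := boolP (N \subset x :: p); last first.
  rewrite inE => /andP[yS xy] yp; apply: (IH y (x :: p)).
  - have /card_uniqP : uniq (y :: x :: p) by rewrite cons_uniq yp.
    have := max_card [in y :: x :: p].
    move=> le E; rewrite E /= in le; move: szp => /=; lia.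
  - by rewrite /= adj_sym xy.
  - by rewrite cons_uniq yp.
  - by move=> z /predU1P[-> // | /sub].
exfalso; case: p => [|y p] in szp pth unq sub Np *.
  have /subset_leq_card : N \subset set0.
    apply/subsetP => z zN; move: (Np _ zN) (zN).
    by rewrite mem_seq1 => /eqP ->; rewrite !inE adj_irrefl andbF.
  by rewrite cards0; lia.
(* [y] follows [x] on the path, so the edges from [x] to its other neighbours are chords, and there
   are at least two. *)
have /card_gt1P[z1 [z2 []]] : 1 < #|N :\ y|.
  by move: deg; rewrite (cardsD1 y N); case: (y \in N); lia.
have Hz z : z \in N :\ y -> z \in p /\ adj z x.
  rewrite 2!inE => /andP[zy zN]; have := Np _ zN; rewrite 2!inE (negbTE zy) /=.
  move: zN; rewrite inE => /andP[_ xz]; rewrite adj_sym xz.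
  by rewrite eq_sym (negbTE (adj_neq xz)).
move=> /Hz[z1p z1x] /Hz[z2p z2x] z12.
have {Hz Np szp} : z2 \in p by [].
case/splitPr: z1p pth unq sub => p1 p2 pth unq sub.
rewrite mem_cat inE eq_sym (negbTE z12) /= => /orP[] z2p'.
  case/splitPr: z2p' pth unq sub => p3 p4; rewrite -catA cat_cons => pth unq _.
  exact: (cactus_no_two_chords pth unq).
case/splitPr: z2p' pth unq sub => p3 p4 pth unq _.
exact: (cactus_no_two_chords pth unq).
Qed.

Hypothesis G_C3_free : triangle_free G.

(** Greedy choice: taking a vertex with at most two neighbours in [S] discards at most three
    vertices. Strictness comes from the last round, where either at most two vertices remain, or
    three remain and the two neighbours are taken instead, being nonadjacent for lack of
    triangles. *)
Lemma cactus_independent_gt_third S :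
  S != set0 -> exists2 I : {set G}, I \subset S & independent I && (#|S| < 3 * #|I|).
Proof.
elim: {S}#|S|.+1 {-2}S (ltnSn #|S|) => // n IH S Sn S0.
have [x xS deg] := cactus_degree_le2 S0.
set N := [set y in S | adj x y] in deg.
have xN : x \notin N by rewrite inE adj_irrefl andbF.
have xNS : x |: N \subset S.
  by apply/subsetP => y /setU1P[-> // |]; rewrite inE => /andP[].
have cxN : #|x |: N| = #|N|.+1 by rewrite cardsU1 xN.
have cS : #|S| = #|S :\: (x |: N)| + #|N|.+1.
  by rewrite cardsDS // cxN subnK // -cxN subset_leq_card.
have indx : independent [set x].
  by apply/independentP => y z /set1P-> /set1P->; rewrite adj_irrefl.
have [E | R0] := eqVneq (S :\: (x |: N)) set0.
  have [N1 | N2] := leqP #|N| 1.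
    exists [set x]; first by rewrite sub1set.
    by rewrite indx cards1 cS E cards0; lia.
  exists N; first by apply/subsetP => y; rewrite inE => /andP[].
  rewrite cS E cards0; apply/andP; split; last by lia.
  apply/independentP => y z; rewrite !inE => /andP[_ xy] /andP[_ xz].
  by apply/negP => yz; apply: G_C3_free; exists x, y, z; rewrite adj_sym in xz.
have [||I IS /andP[/independentP indI cI]] := IH (S :\: (x |: N)) => //.
  by move: Sn; rewrite cS; lia.
have xI y : y \in I -> ~~ adj x y /\ y != x.
  move/(subsetP IS); rewrite !inE => /andP[+ yS].
  by rewrite yS negb_or => /andP[-> ->].
exists (x |: I).
  by rewrite subUset sub1set xS (subset_trans IS) ?subsetDl.
apply/andP; split.
  apply/independentP => y z /setU1P[-> | yI] /setU1P[-> | zI].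
  - by rewrite adj_irrefl.
  - by case: (xI z zI).
  - by rewrite adj_sym; case: (xI y yI).
  - exact: indI.
have xnI : x \notin I by apply/negP => /xI[_]; rewrite eqxx.
by rewrite cardsU1 xnI cS; lia.
Qed.

End Cactus.

(** * Neighbour lists in disjoint unions of edges and 5-cycles *)

Notation blocks m1 m2 :=
  (disjoint_union (copies m1 (complete_graph 2)) (copies m2 (cycle_graph 5))).

Definition block_nbrs m1 m2 (u : blocks m1 m2) : seq (blocks m1 m2) :=
  match u with
  | inl (i, a) => [:: inl (i, rev_ord a)]
  | inr (j, c) => [:: inr (j, ordS c); inr (j, ord_pred c)]
  end.

Lemma adj_blocks m1 m2 (u v : blocks m1 m2) : adj u v = (v \in block_nbrs u).
Proof.
case: u v => [[i a]|[j c]] [[i' a']|[j' c']] //=; rewrite /copies_rel /=.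
  (* The [can_inj] term is the injectivity of [inl], through a left inverse with a dummy value on
     [inr]. *)
  rewrite inE (inj_eq (can_inj (g := fun w => if w is inl y then y else (i, a)) _)) //.
  rewrite xpair_eqE eq_sym; congr (_ && _); rewrite /complete_rel.
  by case: a a' => [[|[|//]] ?] [[|[|//]] ?].
have inr_inj : injective (@inr ('I_m1 * 'I_2) ('I_m2 * 'I_5)) by move=> x y [].
rewrite !inE !(inj_eq inr_inj) !xpair_eqE -andb_orr eq_sym; congr (_ && _).
rewrite /cycle_rel.
by case: c c' => [[|[|[|[|[|//]]]]] ?] [[|[|[|[|[|//]]]]] ?].
Qed.

(** * Leaves and private neighbours in an extremal paired dominating set *)

Section Extremal.
Variable G : sgraph.
Hypothesis G_cactus : cactus G.
Hypothesis G_C3_free : triangle_free G.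
Variables (D : {set G}) (mu : G -> G).
Hypothesis D_min : minset (@paired_dominating G) D.
Hypothesis mu_D : matching_on mu D.
Hypothesis D_card : #|D| = 2 * Gamma G.
Implicit Types (x y z o p q v : G).

Let domD : dominating D.
Proof. by case/minsetP: D_min => /paired_dominatingP[]. Qed.

Let mu_in x : x \in D -> mu x \in D. Proof. by case/mu_D. Qed.
Let mu_adj x : x \in D -> adj x (mu x). Proof. by case/mu_D. Qed.
Let muK x : x \in D -> mu (mu x) = x. Proof. by case/mu_D. Qed.

Let mu_inj x y : x \in D -> y \in D -> mu x = mu y -> x = y.
Proof. by move=> xD yD E; rewrite -(muK xD) E muK. Qed.

Let dominates_refl x : dominates x x. Proof. by rewrite /dominates eqxx. Qed.

Let dominates_adj x y : adj x y -> dominates x y.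
Proof. by rewrite /dominates orbC => ->. Qed.

(** As [mu x] is always a neighbour of [x], these are the vertices of degree one in the subgraph
    induced by [D]. *)
Definition leaves : {set G} := [set x in D | [forall z in D, adj x z ==> (z == mu x)]].

Lemma leavesP x :
  reflect (x \in D /\ {in D, forall z, adj x z -> z = mu x}) (x \in leaves).
Proof.
rewrite inE; apply: (iffP andP) => -[xD H]; split=> //.
  by move=> z zD xz; apply/eqP; move/forall_inP/(_ z zD): H; rewrite xz.
by apply/forall_inP => z zD; apply/implyP => /(H z zD) ->.
Qed.

(* One leaf from every matching edge that has one: the tie between two leaves
   matched to each other is broken by the enumeration order. *)
Definition leaf_reps : {set G} :=
  [set x in leaves | (mu x \notin leaves) || (enum_rank x < enum_rank (mu x))].

Lemma leaf_reps_leaf x : x \in leaf_reps -> x \in leaves.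
Proof. by rewrite inE => /andP[]. Qed.

Lemma leaf_reps_D x : x \in leaf_reps -> x \in D.
Proof. by move/leaf_reps_leaf/leavesP => []. Qed.

Lemma leaf_reps_nbr x z : x \in leaf_reps -> z \in D -> adj x z -> z = mu x.
Proof. by move/leaf_reps_leaf/leavesP => [_ H]; apply: H. Qed.

Lemma leaf_reps_mu x : x \in leaf_reps -> mu x \notin leaf_reps.
Proof.
move=> xX; have xD := leaf_reps_D xX; move: xX; rewrite inE => /andP[xL H].
apply/negP; rewrite inE muK // xL => /andP[mxL] /=.
by rewrite mxL /= in H; rewrite ltnNge ltnW.
Qed.

Lemma leaf_reps_independent : {in leaf_reps &, forall x y, ~~ adj x y}.
Proof.
move=> x y xX yX; apply/negP => /(leaf_reps_nbr xX (leaf_reps_D yX)) E.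
by move: (leaf_reps_mu xX); rewrite -E yX.
Qed.

Lemma leaf_reps_cover x :
  (x \in leaves) || (mu x \in leaves) -> x \in D ->
  x \in leaf_reps \/ exists2 y, y \in leaf_reps & x = mu y.
Proof.
move=> xL xD; suff : (x \in leaf_reps) || (mu x \in leaf_reps).
  by case/orP; [left | right; exists (mu x) => //; rewrite muK].
rewrite inE [mu x \in leaf_reps]inE muK //.
case: (x \in leaves) xL; case: (mu x \in leaves) => //= _.
(* Both ends are leaves here; being adjacent they are distinct, so one rank is smaller. *)
rewrite -neq_ltn; apply: contraTneq (mu_adj xD) => /ord_inj/enum_rank_inj {1}->.
by rewrite adj_irrefl.
Qed.

(* The vertices of the matching edges without a leaf, and the vertices outside D
   with exactly one neighbour in D, that neighbour being in B. *)
Let B := [set x in D | (x \notin leaves) && (mu x \notin leaves)].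
Let V := [set v in ~: D | [exists x in B, adj v x && [forall z in D, adj v z ==> (z == x)]]].

Let V_priv v : v \in V -> exists2 x, x \in B &
  [/\ v \notin D, adj v x & {in D, forall z, adj v z -> z = x}].
Proof.
rewrite 2!inE => /andP[vD /exists_inP[x xB /andP[vx H]]]; exists x => //; split=> //.
by move=> z zD vz; apply/eqP; move/forall_inP/(_ z zD): H; rewrite vz.
Qed.

Lemma matching_on_minus_edge x : x \in D -> matching_on mu (D :\ x :\ mu x).
Proof.
move=> xD y; rewrite !inE => /and3P[ymx yx yD].
rewrite mu_in ?mu_adj ?muK // andbT; split=> //; apply/andP; split.
  by apply: contraNneq yx => /(mu_inj yD xD) ->.
by apply: contraNneq ymx => <-; rewrite muK.
Qed.

(** Removing the edge of [x] leaves some [v] undominated. If [v] were in [D], it would be an end of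
    that edge and a leaf; outside [D] it sees exactly one of the two ends, for lack of triangles. *)
Let B_private x : x \in B -> exists2 v, v \in V & adj v x || adj v (mu x).
Proof.
rewrite inE => /and3P[xD xL mxL].
have [|v Hv] := minimal_paired_dominating_sub D_min _ (matching_on_minus_edge xD).
  apply/andP; split; first by apply/subsetP => y; rewrite !inE => /and3P[].
  by apply/subsetPn; exists x; rewrite ?inE ?xD ?eqxx ?andbF.
have Hv' y : y \in D -> dominates v y -> y = x \/ y = mu x.
  move=> yD vy; have [-> | yx] := eqVneq y x; first by left.
  have [-> | ymx] := eqVneq y (mu x); first by right.
  by have := Hv y; rewrite !inE yx ymx yD vy => /(_ isT).
have vD : v \notin D.
  apply/negP => vD; have [E | E] := Hv' v vD (dominates_refl v); subst v.
    case/negP: xL; apply/leavesP; split=> // z zD xz.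
    have [E | //] := Hv' z zD (dominates_adj xz).
    by rewrite E adj_irrefl in xz.
  case/negP: mxL; apply/leavesP; split=> // z zD xz; rewrite muK //.
  have [// | E] := Hv' z zD (dominates_adj xz).
  by rewrite E adj_irrefl in xz.
have adjv y : y \in D -> adj v y -> y = x \/ y = mu x.
  by move=> yD /dominates_adj; apply: Hv'.
have key y : y \in B -> adj v y -> (y = x \/ y = mu x) -> v \in V.
  move=> yB vy yE; rewrite !inE vD; apply/exists_inP; exists y => //; rewrite vy /=.
  apply/forall_inP => z zD; apply/implyP => vz; apply/eqP.
  have tri a b : adj v a -> adj v b -> ~ adj a b.
    move=> va vb ab; apply: G_C3_free; exists v, a, b; split=> //.
    by rewrite adj_sym.
  have mx := mu_adj xD.
  have [zE | zE] := adjv z zD vz; case: yE => yE; subst => //.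
    by case: (tri _ _ vz vy).
  by case: (tri _ _ vy vz).
have [y yD /orP[/eqP E | vy]] := dominatingP _ domD v; first by rewrite E yD in vD.
have [E | E] := adjv y yD vy; subst y; exists v; rewrite ?vy ?orbT //.
  by apply: (key x) => //; [rewrite inE xD xL | left].
by apply: (key (mu x)) => //; [rewrite inE yD mxL muK // xL | right].
Qed.

(** Suppose [B] is nonempty. Since [#|B| <= 2 * #|V|], an independent subset [I] of [B :|: V] with
    more than a third of the vertices has more than [#|B| / 2]. The leaf representatives number at
    least half of [D :\: B], so together with [I] they exceed [Gamma G]. *)
Lemma leaf_on_matching_edge x : x \in D -> (x \in leaves) || (mu x \in leaves).
Proof.
move=> xD; apply/negbNE; rewrite negb_or; apply/negP => xB.
have B0 : B :|: V != set0 by apply/set0Pn; exists x; rewrite inE [x \in B]inE xD xB.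
have [I IBV /andP[/independentP indI cI]] :=
  cactus_independent_gt_third G_cactus G_C3_free B0.
(* The only neighbour in [D] of a vertex of [V]; the default does not occur there. *)
pose n v := odflt v [pick y in B | adj v y].
have BV : #|B| <= 2 * #|V|.
  have : B \subset n @: V :|: mu @: (n @: V).
    apply/subsetP => y yB; have [v vV vy] := B_private yB.
    have nE z : z \in B -> adj v z -> n v = z.
      move=> zB vz; rewrite /n; case: pickP => [w /andP[wB vw] | /(_ z)]; last by rewrite zB vz.
      have [u uB [_ _ H]] := V_priv vV.
      have BD a : a \in B -> a \in D by rewrite inE => /andP[].
      by rewrite /= (H w) ?BD // (H z) ?BD.
    have [yD myB] : y \in D /\ mu y \in B.
      move: yB; rewrite inE => /and3P[yD yL myL].
      by rewrite inE mu_in // muK // myL yL.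
    case/orP: vy => vy; rewrite inE; apply/orP.
      by left; apply/imsetP; exists v => //; rewrite (nE y).
    right; apply/imsetP; exists (mu y); rewrite ?muK //.
    by apply/imsetP; exists v => //; rewrite (nE (mu y)).
  move/subset_leq_card/leq_trans; apply.
  rewrite mul2n -addnn; apply: leq_trans (leq_card_setU _ _) _.
  by rewrite leq_add // ?leq_imset_card // (leq_trans (leq_imset_card _ _)) // leq_imset_card.
have cBV : #|B :|: V| = #|B| + #|V|.
  rewrite cardsU; suff -> : B :&: V = set0 by rewrite cards0 subn0.
  by apply/setP => y; rewrite !inE; case: (y \in D); rewrite ?andbF.
have XB y : y \in leaf_reps -> y \notin B.
  by move/leaf_reps_leaf => yL; rewrite inE yL andbF.
have cD : #|D :\: B| <= 2 * #|leaf_reps|.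
  have : D :\: B \subset leaf_reps :|: mu @: leaf_reps.
    apply/subsetP => y; rewrite inE => /andP[yB yD].
    have yL : (y \in leaves) || (mu y \in leaves).
      by move: yB; rewrite inE yD /= negb_and !negbK.
    case: (leaf_reps_cover yL yD) => [yX | [z zX ->]]; rewrite inE ?yX //.
    by rewrite imset_f ?orbT.
  move/subset_leq_card/leq_trans; apply.
  rewrite mul2n -addnn; apply: leq_trans (leq_card_setU _ _) _.
  by rewrite leq_add // leq_imset_card.
have XI : leaf_reps :&: I = set0.
  apply/eqP/set0Pn => -[y]; rewrite inE => /andP[yX /(subsetP IBV)].
  by rewrite inE (negbTE (XB _ yX)) !inE (leaf_reps_D yX).
(* Within [D], a leaf sees only its mate, whose edge has a leaf and so misses [B], while a vertex of
   [V] sees only a vertex of [B]. *)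
have XIadj y z : y \in leaf_reps -> z \in I -> ~~ adj y z.
  move=> yX zI; apply/negP => yz.
  have /(subsetP IBV) := zI; rewrite inE => /orP[zB | zV].
    have zD : z \in D by move: zB; rewrite inE => /andP[].
    have zE := leaf_reps_nbr yX zD yz; move: zB; rewrite zE inE.
    by rewrite muK ?(leaf_reps_D yX) // (leaf_reps_leaf yX) !andbF.
  have [w wB [_ _ H]] := V_priv zV.
  have E : y = w by apply: H; rewrite ?(leaf_reps_D yX) // adj_sym.
  by move: (XB _ yX); rewrite E wB.
have : #|leaf_reps :|: I| <= Gamma G.
  apply/independent_card_Gamma/independentP => y z /setUP[yX | yI] /setUP[zX | zI].
  - exact: leaf_reps_independent.
  - exact: XIadj.
  - by rewrite adj_sym XIadj.
  - exact: indI.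
rewrite cardsU XI cards0 subn0.
have BD : B \subset D by apply/subsetP => y; rewrite inE => /andP[].
have := subset_leq_card BD.
move: cD cI; rewrite cardsDS // cBV D_card; lia.
Qed.

(** * Vertices outside [D] and the 5-cycles they close *)

Notation X := leaf_reps.

Lemma leaf_or_mate_of_leaf x : x \in D -> x \in X \/ exists2 y, y \in X & x = mu y.
Proof. by move=> xD; apply: leaf_reps_cover (leaf_on_matching_edge xD) xD. Qed.

Lemma leaf_reps_card : Gamma G <= #|X|.
Proof.
have : D \subset X :|: mu @: X.
  apply/subsetP => y /leaf_or_mate_of_leaf[yX | [z zX ->]]; rewrite inE ?yX //.
  by rewrite imset_f ?orbT.
move/subset_leq_card; rewrite D_card => le.
have := leq_trans le (leq_card_setU _ _); have := leq_imset_card mu X; lia.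
Qed.

Definition flip o x := if adj o x then mu x else x.

Lemma flip_D o x : x \in X -> flip o x \in D.
Proof. by move/leaf_reps_D => xD; rewrite /flip; case: ifP => _ //; apply: mu_in. Qed.

Lemma flip_inj o : {in X &, injective (flip o)}.
Proof.
move=> x y xX yX; rewrite /flip; case: ifP => _; case: ifP => _ // E.
- exact: (mu_inj (leaf_reps_D xX) (leaf_reps_D yX)).
- by move: (leaf_reps_mu xX); rewrite E yX.
- by move: (leaf_reps_mu yX); rewrite -E xX.
Qed.

Lemma leaf_reps_adj_mate x y : x \in X -> y \in X -> adj x (mu y) -> x = y.
Proof.
move=> xX yX xy; have yD := leaf_reps_D yX; have xD := leaf_reps_D xX.
by apply: (mu_inj xD yD); rewrite -(leaf_reps_nbr xX (mu_in yD) xy).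
Qed.

(** The added vertex and the flipping vertex are separate parameters because [outside_independent]
    combines two different outside vertices. *)
Lemma flip_card o o' : o' \notin D -> #|o' |: [set flip o x | x in X]| = #|X|.+1.
Proof.
move=> o'D; rewrite cardsU1 (card_in_imset (@flip_inj o)).
case: (boolP (_ \in _)) => // /imsetP[x xX E].
by move: (flip_D o xX); rewrite -E (negbTE o'D).
Qed.

(* Otherwise o together with the flipped leaves is independent of size
   Gamma G + 1. *)
Lemma outside_two_leaves o : o \notin D ->
  exists x y, [/\ x \in X, y \in X, adj o x, adj o y & adj (mu x) (mu y)].
Proof.
move=> oD.
have [/exists_inP[x xX /exists_inP[y yX /and3P[? ? ?]]] | H] := boolP
  [exists x in X, exists y in X, [&& adj o x, adj o y & adj (mu x) (mu y)]].
  by exists x, y.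
have ind1 x : x \in X -> ~~ adj o (flip o x).
  move=> xX; rewrite /flip; case: ifP => [ox | -> //].
  apply/negP => omx; apply: G_C3_free; exists o, x, (mu x).
  by rewrite ox mu_adj ?(leaf_reps_D xX) // adj_sym.
have : #|o |: [set flip o x | x in X]| <= Gamma G.
  apply/independent_card_Gamma/independentP.
  move=> y z /setU1P[-> | /imsetP[x xX ->]] /setU1P[-> | /imsetP[x' x'X ->]].
  - by rewrite adj_irrefl.
  - exact: ind1.
  - by rewrite adj_sym ind1.
  (* Two flipped mates are nonadjacent by [H]; a leaf adjacent to a flipped mate would be the
     flipped leaf itself. *)
  have := ind1 x xX; have := ind1 x' x'X.
  rewrite /flip; case: ifP => ox'; case: ifP => ox _ _.
  - move/exists_inPn/(_ x xX)/exists_inPn/(_ x' x'X): H.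
    by rewrite ox ox'.
  - apply: contraFN ox => /(leaf_reps_adj_mate xX x'X) -> //.
  - rewrite adj_sym; apply: contraFN ox' => /(leaf_reps_adj_mate x'X xX) -> //.
  - exact: leaf_reps_independent.
by rewrite flip_card //; have := leaf_reps_card; lia.
Qed.

(* By minimality, D without x and y, with mu x matched to mu y, does not
   dominate. *)
Lemma adjacent_mates_private x y :
  x \in X -> y \in X -> adj (mu x) (mu y) ->
  exists o, [/\ o \notin D, adj o x, adj o y
              & {in D, forall z, adj o z -> z = x \/ z = y}].
Proof.
move=> xX yX mxy.
have xD := leaf_reps_D xX; have yD := leaf_reps_D yX.
pose nu z := if z == mu x then mu y else if z == mu y then mu x else mu z.
have mneq := adj_neq mxy.
have xmy : x != mu y by apply: contraTneq xX => ->; apply: leaf_reps_mu.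
have ymx : y != mu x by apply: contraTneq yX => ->; apply: leaf_reps_mu.
have xmx := adj_neq (mu_adj xD); have ymy := adj_neq (mu_adj yD).
have [||o Ho] := minimal_paired_dominating_sub (B := D :\ x :\ y) (mu := nu) D_min.
- apply/andP; split; first by apply/subsetP => z; rewrite !inE => /and3P[].
  by apply/subsetPn; exists x; rewrite ?inE ?xD ?eqxx ?andbF.
- move=> z; rewrite !inE => /and3P[zy zx zD]; rewrite /nu.
  have [-> | zmx] := eqVneq z (mu x).
    rewrite [mu y == mu x]eq_sym (negbTE mneq) eqxx mxy mu_in // andbT.
    by split=> //; apply/andP; split; rewrite eq_sym.
  have [-> | zmy] := eqVneq z (mu y).
    rewrite eqxx adj_sym mxy mu_in // andbT.
    by split=> //; apply/andP; split; rewrite eq_sym.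
  rewrite mu_in // mu_adj // muK // andbT.
  have -> : mu z == mu x = false.
    by apply: contraNF zx => /eqP/(mu_inj zD xD) ->.
  have -> : mu z == mu y = false.
    by apply: contraNF zy => /eqP/(mu_inj zD yD) ->.
  split=> //; apply/andP; split.
    by apply: contraNneq zmy => <-; rewrite muK.
  by apply: contraNneq zmx => <-; rewrite muK.
have Ho' z : z \in D -> dominates o z -> z = x \/ z = y.
  move=> zD oz; have [-> | zx] := eqVneq z x; first by left.
  have [-> | zy] := eqVneq z y; first by right.
  by have := Ho z; rewrite !inE zx zy zD oz => /(_ isT).
have oD : o \notin D.
  apply/negP => oD.
  have [E | E] := Ho' o oD (dominates_refl o).
    subst o; have [E' | E'] := Ho' (mu x) (mu_in xD) (dominates_adj (mu_adj xD)).
      by rewrite E' eqxx in xmx.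
    by rewrite E' eqxx in ymx.
  subst o; have [E' | E'] := Ho' (mu y) (mu_in yD) (dominates_adj (mu_adj yD)).
    by rewrite E' eqxx in xmy.
  by rewrite E' eqxx in ymy.
have adjo z : z \in D -> adj o z -> z = x \/ z = y.
  by move=> zD /dominates_adj; apply: Ho'.
(* [outside_two_leaves] gives two leaves seen by [o], distinct because their mates are adjacent;
   they can only be [x] and [y]. *)
exists o; split=> //; have [a [b [aX bX oa ob mab]]] := outside_two_leaves oD.
all: have nab : a <> b by move=> E; rewrite E adj_irrefl in mab.
all: have [Ea | Ea] := adjo a (leaf_reps_D aX) oa;
     have [Eb | Eb] := adjo b (leaf_reps_D bX) ob; subst => //.
Qed.

Let five_cycle x y o : o \notin D -> x \in X -> y \in X -> adj o x -> adj o y ->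
  adj (mu x) (mu y) -> graph_cycle [:: x; mu x; mu y; y; o].
Proof.
move=> oD xX yX ox oy mxy; split=> //.
have xD := leaf_reps_D xX; have yD := leaf_reps_D yX.
have oneq z : z \in D -> z != o by apply: contraTneq => ->.
have xy : x != y by apply: contraTneq mxy => ->; rewrite adj_irrefl.
have xmy : x != mu y by apply: contraTneq xX => ->; apply: leaf_reps_mu.
have ymx : mu x != y by apply: contraTneq yX => <-; apply: leaf_reps_mu.
apply/andP; split.
  by rewrite /= mu_adj // mxy ox (adj_sym _ y) mu_adj // adj_sym oy.
rewrite /= !inE !negb_or xy xmy ymx !oneq ?mu_in // !adj_neq ?mu_adj //.
by rewrite adj_sym mu_adj.
Qed.

(** The two 5-cycles share the edge from [x] to [mu x], hence all their vertices, and each has a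
    single vertex outside [D]. *)
Let five_cycle_apex x y y' o o' :
  o \notin D -> o' \notin D -> x \in X -> y \in X -> y' \in X ->
  adj o x -> adj o y -> adj (mu x) (mu y) ->
  adj o' x -> adj o' y' -> adj (mu x) (mu y') -> o = o'.
Proof.
move=> oD o'D xX yX y'X ox oy mxy o'x o'y' mxy'.
have c1 := five_cycle oD xX yX ox oy mxy.
have c2 := five_cycle o'D xX y'X o'x o'y' mxy'.
have := cactus_cycle_mem G_cactus (z := o) c2 c1.
rewrite !inE eqxx !orbT => /(_ isT).
have oneq z : z \in D -> o == z = false by move=> zD; apply: contraNF oD => /eqP ->.
have xD := leaf_reps_D xX; have y'D := leaf_reps_D y'X.
by rewrite (oneq _ xD) (oneq _ y'D) (oneq _ (mu_in xD)) (oneq _ (mu_in y'D)) => /eqP.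
Qed.

(** The outside vertex that [adjacent_mates_private] provides for the two leaves seen by [o] is [o]
    itself, by [five_cycle_apex]. *)
Lemma outside_neighbours o : o \notin D ->
  exists pq : G * G, [/\ pq.1 \in X, pq.2 \in X, adj (mu pq.1) (mu pq.2)
     & {in D, forall z, adj o z = (z == pq.1) || (z == pq.2)}].
Proof.
move=> oD; have [x [y [xX yX ox oy mxy]]] := outside_two_leaves oD.
have [o' [o'D o'x o'y H]] := adjacent_mates_private xX yX mxy.
have E : o = o' by apply: (@five_cycle_apex x y y).
subst o'; exists (x, y); split=> //= z zD; apply/idP/orP => [oz | [] /eqP -> //].
by case: (H z zD oz) => ->; rewrite eqxx; auto.
Qed.

Lemma outside_nbr_leaf o x : o \notin D -> x \in D -> adj o x -> x \in X.
Proof.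
move=> /outside_neighbours[[p q] /= [pX qX _ H]] xD.
by rewrite H // => /orP[] /eqP ->.
Qed.

(** Both pairs of adjacent mates yield the same outside vertex, whose neighbours in [D] are then
    both [x], [y] and [x], [y']. *)
Lemma mate_nbr_uniq x y y' : x \in X -> y \in X -> y' \in X ->
  adj (mu x) (mu y) -> adj (mu x) (mu y') -> y = y'.
Proof.
move=> xX yX y'X mxy mxy'.
have [o [oD ox oy H]] := adjacent_mates_private xX yX mxy.
have [o' [o'D o'x o'y' H']] := adjacent_mates_private xX y'X mxy'.
have E : o = o' by apply: (@five_cycle_apex x y y').
subst o'; have [E | //] := H' y (leaf_reps_D yX) oy.
by rewrite E adj_irrefl in mxy.
Qed.

Let outside_mate o x : o \notin D -> x \in X -> adj o x ->
  exists y, [/\ y \in X, adj o y & adj (mu x) (mu y)].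
Proof.
move=> /outside_neighbours[[p q] /= [pX qX mpq H]] xX.
have pD := leaf_reps_D pX; have qD := leaf_reps_D qX.
rewrite H ?leaf_reps_D // => /orP[] /eqP ->.
  by exists q; rewrite H ?eqxx ?orbT.
by exists p; rewrite H ?eqxx ?orbT // adj_sym.
Qed.

Lemma outside_nbr_uniq o o' x : o \notin D -> o' \notin D -> x \in X ->
  adj o x -> adj o' x -> o = o'.
Proof.
move=> oD o'D xX ox o'x.
have [y [yX oy mxy]] := outside_mate oD xX ox.
have [y' [y'X o'y' mxy']] := outside_mate o'D xX o'x.
exact: (@five_cycle_apex x y y').
Qed.

(* An edge between o and o' makes {o} and the leaves flipped along o' a
   minimal dominating set of size Gamma G + 1; its private neighbours are o'
   for o, mu x for the neighbours x of o, and the leaves themselves otherwise. *)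
Lemma outside_independent o o' : o \notin D -> o' \notin D -> ~~ adj o o'.
Proof.
move=> oD o'D; apply/negP => oo'.
have oneo' := adj_neq oo'.
have notboth x : x \in X -> adj o x -> adj o' x = false.
  move=> xX ox; apply: contraNF oneo' => o'x.
  by rewrite (outside_nbr_uniq oD o'D xX ox o'x).
have : #|o |: [set flip o' x | x in X]| <= Gamma G; last first.
  by rewrite flip_card //; have := leaf_reps_card; lia.
set S := o |: _.
have XS x : x \in X -> flip o' x \in S by move=> xX; rewrite !inE imset_f ?orbT.
apply: irredundant_dominating_card.
  (* Each matching edge keeps one end in [S], which dominates both ends; [o] dominates [o']; any
     other outside vertex has a leaf neighbour not adjacent to [o'], hence unflipped. *)
  apply/dominatingP => z; have [zD | zD] := boolP (z \in D).
    have [x xX zx] : exists2 x, x \in X & (z == x) || (z == mu x).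
      by case: (leaf_or_mate_of_leaf zD) => [zX | [y yX ->]]; [exists z | exists y]; rewrite ?eqxx ?orbT.
    have xD := leaf_reps_D xX.
    exists (flip o' x); first exact: XS.
    rewrite /flip /dominates; case: ifP => _; case/orP: zx => /eqP ->;
      by rewrite ?eqxx ?mu_adj ?orbT // adj_sym mu_adj ?orbT.
  have [-> | zo'] := eqVneq z o'.
    by exists o; rewrite ?setU11 // /dominates adj_sym oo' orbT.
  have [x [_ [xX _ zx _ _]]] := outside_two_leaves zD.
  exists x; last by rewrite /dominates zx orbT.
  suff : adj o' x = false by move=> E; have := XS x xX; rewrite /flip E.
  by apply: contraNF zo' => o'x; rewrite (outside_nbr_uniq zD o'D xX zx o'x).
move=> z /setU1P[-> | /imsetP[x xX ->]].
  exists o'; first by rewrite /dominates adj_sym oo' orbT.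
  move=> w /setU1P[-> // | /imsetP[y yX ->]] /orP[/eqP E | ].
    by move: (flip_D o' yX); rewrite -E (negbTE o'D).
  rewrite /flip; case: ifP => [_ | -> //] H.
  have mD := mu_in (leaf_reps_D yX).
  by have := outside_nbr_leaf o'D mD H; rewrite (negbTE (leaf_reps_mu yX)).
have xD := leaf_reps_D xX.
have [o'x | o'x] := boolP (adj o' x).
  exists x; first by rewrite /flip o'x /dominates mu_adj ?orbT.
  move=> w /setU1P[-> | /imsetP[y yX ->]].
    move=> /orP[/eqP E | xo]; first by rewrite -E xD in oD.
    by rewrite adj_sym in xo; rewrite (notboth x xX xo) in o'x.
  rewrite {1}/flip; case: ifP => o'y /orP[/eqP E | xy].
  - by move: (leaf_reps_mu yX); rewrite -E xX.
  - by rewrite (leaf_reps_adj_mate xX yX xy).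
  - by rewrite E o'y in o'x.
  - by have := leaf_reps_independent xX yX; rewrite xy.
have fx : flip o' x = x by rewrite /flip (negbTE o'x).
rewrite fx; have [ox | ox] := boolP (adj o x); last first.
  exists x => // w /setU1P[-> | /imsetP[y yX ->]] /orP[/eqP // | ].
    by rewrite adj_sym (negbTE ox).
  rewrite /flip; case: ifP => o'y xy.
    by rewrite (leaf_reps_adj_mate xX yX xy) o'y in o'x.
  by have := leaf_reps_independent xX yX; rewrite xy.
exists (mu x); first by rewrite /dominates adj_sym mu_adj ?orbT.
move=> w /setU1P[-> | /imsetP[y yX ->]].
  move=> /orP[/eqP E | xo]; first by rewrite -E mu_in in oD.
  rewrite adj_sym in xo.
  by have := outside_nbr_leaf oD (mu_in xD) xo; rewrite (negbTE (leaf_reps_mu xX)).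
rewrite /flip; case: ifP => o'y /orP[/eqP E | xy].
- by rewrite (mu_inj xD (leaf_reps_D yX) E) o'y in o'x.
(* The only mate adjacent to [mu x] belongs to the other neighbour of [o], which [o'] does not see
   and so does not flip. *)
- have [y' [y'X oy' mxy']] := outside_mate oD xX ox.
  by rewrite (mate_nbr_uniq xX yX y'X xy mxy') (notboth y') in o'y.
- by move: (leaf_reps_mu xX); rewrite E yX.
- by rewrite adj_sym in xy; rewrite (leaf_reps_adj_mate yX xX xy).
Qed.

(** * Neighbourhoods in [G] and the isomorphism with edges and 5-cycles *)

Let K2_reps := [set x in X | [forall o in ~: D, ~~ adj o x]].

Let K2_repsP x :
  reflect (x \in X /\ forall o, o \notin D -> ~~ adj o x) (x \in K2_reps).
Proof.
rewrite [x \in K2_reps]inE; apply: (iffP andP) => -[xX H]; split=> //.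
  by move=> o oD; apply: (forall_inP H); rewrite inE.
by apply/forall_inP => o; rewrite inE => /H.
Qed.

Let adj_leaf_K2 x z : x \in K2_reps -> adj x z = (z == mu x).
Proof.
case/K2_repsP => xX Hx; apply/idP/eqP => [xz | ->]; last exact/mu_adj/leaf_reps_D.
apply: leaf_reps_nbr => //; apply/negbNE/negP => zD.
by have := Hx z zD; rewrite adj_sym xz.
Qed.

(** If [mu x] were adjacent to another mate, [adjacent_mates_private] would give [x] a neighbour
    outside [D]. *)
Let adj_mate_K2 x z : x \in K2_reps -> adj (mu x) z = (z == x).
Proof.
case/K2_repsP => xX Hx; have xD := leaf_reps_D xX.
apply/idP/eqP => [xz | ->]; last by rewrite adj_sym mu_adj.
have [zD | zD] := boolP (z \in D); last first.
  rewrite adj_sym in xz; have := outside_nbr_leaf zD (mu_in xD) xz.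
  by rewrite (negbTE (leaf_reps_mu xX)).
case: (leaf_or_mate_of_leaf zD) => [zX | [y yX E]].
  by rewrite adj_sym in xz; apply: leaf_reps_adj_mate xz.
rewrite E in xz; have [o [oD ox _ _]] := adjacent_mates_private xX yX xz.
by have := Hx o oD; rewrite ox.
Qed.

Let adj_leaf_C5 o x z : o \notin D -> x \in X -> adj o x ->
  adj x z = (z == o) || (z == mu x).
Proof.
move=> oD xX ox; have xD := leaf_reps_D xX.
apply/idP/orP => [xz | [/eqP -> | /eqP ->]]; [ | by rewrite adj_sym | exact: mu_adj].
have [zD | zD] := boolP (z \in D); first by right; rewrite (leaf_reps_nbr xX zD xz).
by left; rewrite adj_sym in xz; rewrite (outside_nbr_uniq zD oD xX xz ox).
Qed.

Let adj_mate_C5 x y z : x \in X -> y \in X -> adj (mu x) (mu y) ->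
  adj (mu x) z = (z == x) || (z == mu y).
Proof.
move=> xX yX mxy; have xD := leaf_reps_D xX.
apply/idP/orP => [xz | [] /eqP -> //]; last by rewrite adj_sym mu_adj.
have [zD | zD] := boolP (z \in D); last first.
  rewrite adj_sym in xz; have := outside_nbr_leaf zD (mu_in xD) xz.
  by rewrite (negbTE (leaf_reps_mu xX)).
case: (leaf_or_mate_of_leaf zD) => [zX | [y' y'X E]].
  by left; rewrite adj_sym in xz; rewrite (leaf_reps_adj_mate zX xX xz).
by right; rewrite E in xz *; rewrite (mate_nbr_uniq xX y'X yX xz mxy).
Qed.

Lemma extremal_isomorphic :
  exists m1 m2 : nat,
    isomorphic G (disjoint_union (copies m1 (complete_graph 2))
                                 (copies m2 (cycle_graph 5))).
Proof.
(* A choice of the two leaf neighbours of every outside vertex, with dummy values on [D]. *)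
have [pq Hpq] : exists pq : G -> G * G, forall o, o \notin D ->
    [/\ (pq o).1 \in X, (pq o).2 \in X, adj (mu (pq o).1) (mu (pq o).2)
      & {in D, forall z, adj o z = (z == (pq o).1) || (z == (pq o).2)}].
  apply: (fin_all_exists (P := fun o u => o \notin D ->
    [/\ u.1 \in X, u.2 \in X, adj (mu u.1) (mu u.2)
      & {in D, forall z, adj o z = (z == u.1) || (z == u.2)}])) => o.
  have [oD | oD] := boolP (o \in D); first by exists (o, o).
  by have [u Hu] := outside_neighbours oD; exists u.
(* One edge per leaf without outside neighbours, and one 5-cycle per vertex outside [D]. *)
exists #|K2_reps|, #|~: D|; set H := disjoint_union _ _.
pose ov (j : 'I_#|~: D|) : G := enum_val j.
pose xv (i : 'I_#|K2_reps|) : G := enum_val i.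
have ovD j : ov j \notin D by have := enum_valP j; rewrite inE.
have xvK i : xv i \in K2_reps := enum_valP i.
have xvX i : xv i \in X by have /K2_repsP[] := xvK i.
pose p j := (pq (ov j)).1; pose q j := (pq (ov j)).2.
have pX j : p j \in X by have [] := Hpq _ (ovD j).
have qX j : q j \in X by have [] := Hpq _ (ovD j).
have mpq j : adj (mu (p j)) (mu (q j)) by have [] := Hpq _ (ovD j).
have mqp j : adj (mu (q j)) (mu (p j)) by rewrite adj_sym.
have ovN j : {in D, forall z, adj (ov j) z = (z == p j) || (z == q j)}.
  by have [] := Hpq _ (ovD j).
have op j : adj (ov j) (p j) by rewrite ovN ?eqxx // leaf_reps_D.
have oq j : adj (ov j) (q j) by rewrite ovN ?eqxx ?orbT // leaf_reps_D.
have pqneq j : p j != q j by apply: contraTneq (mpq j) => ->; rewrite adj_irrefl.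
pose g (u : H) : G := match u with
  | inl (i, a) => if val a == 0 then xv i else mu (xv i)
  | inr (j, c) => nth (ov j) [:: ov j; p j; mu (p j); mu (q j); q j] (val c)
  end.
(* Once [g] is known to be bijective, carrying neighbour lists to full neighbourhoods makes its
   inverse an isomorphism. *)
have adj_g u z : adj (g u) z = (z \in map g (block_nbrs u)).
  case: u => [[i [[|[|//]] ?]]|[j [[|[|[|[|[|//]]]]] ?]]] /=; rewrite !inE.
  - exact: adj_leaf_K2.
  - exact: adj_mate_K2.
  - have [zD | zD] := boolP (z \in D); first by rewrite ovN.
    rewrite (negbTE (outside_independent (ovD j) zD)).
    by apply/esym/negbTE; rewrite negb_or; apply/andP; split;
      apply: contraNneq zD => ->; apply: leaf_reps_D.
  - by rewrite (adj_leaf_C5 _ (ovD j) (pX j) (op j)) orbC.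
  - by rewrite (adj_mate_C5 _ (pX j) (qX j) (mpq j)) orbC.
  - exact: (adj_mate_C5 _ (qX j) (pX j) (mqp j)).
  - exact: (adj_leaf_C5 _ (ovD j) (qX j) (oq j)).
(* kind is 0 outside D, 1 on leaves in X and 2 on their mates. *)
pose kind (u : H) := match u with
  | inl (i, a) => (val a).+1
  | inr (j, c) => nth 0 [:: 0; 1; 2; 2; 1] (val c)
  end.
pose base (u : H) : G := match u with
  | inl (i, a) => xv i
  | inr (j, c) => nth (ov j) [:: ov j; p j; p j; q j; q j] (val c)
  end.
have g_base u : g u = if kind u == 2 then mu (base u) else base u.
  by case: u => [[i [[|[|//]] ?]]|[j [[|[|[|[|[|//]]]]] ?]]].
have base_X u : if kind u == 0 then base u \notin D else base u \in X.
  by case: u => [[i [[|[|//]] ?]]|[j [[|[|[|[|[|//]]]]] ?]]] /=.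
have kind_le2 u : kind u <= 2.
  by case: u => [[i [[|[|//]] ?]]|[j [[|[|[|[|[|//]]]]] ?]]].
(* The complement of [D], the set [X] and the mates of [X] are disjoint, which fixes the kind; [mu]
   is injective on [D], which fixes the base. *)
have base_inj (u v : H) : g u = g v -> kind u = kind v /\ base u = base v.
  rewrite !g_base; move: (base_X u) (base_X v) (kind_le2 u) (kind_le2 v).
  have muX (x y : G) : x \in X -> y \in X -> x <> mu y.
    by move=> xX yX E; move: (leaf_reps_mu yX); rewrite -E xX.
  have XD := leaf_reps_D; have mXD (x : G) (xX : x \in X) := mu_in (XD x xX).
  move: (base u) (base v) (kind u) (kind v) => x y.
  case=> [|[|[|//]]] [|[|[|//]]] //= Hx Hy _ _ E.
  - by rewrite E XD in Hx.
  - by rewrite E mXD in Hx.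
  - by rewrite -E XD in Hy.
  - by case: (muX x y).
  - by rewrite -E mXD in Hy.
  - by case: (muX y x).
  - by split=> //; apply: (mu_inj (XD _ Hx) (XD _ Hy)).
have xv_nadj i j : adj (ov j) (xv i) = false.
  by have /K2_repsP[_ Hx] := xvK i; apply/negbTE/Hx/ovD.
have ov_xv i j : ov j <> xv i.
  by move=> E; have := ovD j; rewrite E leaf_reps_D.
have base_adj j c : val c != 0 -> adj (ov j) (base (inr (j, c))).
  by case: c => [[|[|[|[|[|//]]]]] ?] /=.
have g_inj : injective g.
  move=> u v /base_inj[]; case: u v => [[i a]|[j c]] [[i' a']|[j' c']].
  - by move=> [/val_inj ->] /enum_val_inj ->.
  (* A vertex of [K2_reps] has no neighbour outside [D], whereas the base of a 5-cycle vertex is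
     [ov] or a neighbour of it. *)
  - move=> _ E; have := base_adj j' c'; rewrite -E xv_nadj.
    by case: c' E => [[|c'] ?] /= E; [case: (ov_xv i j') | move/(_ isT)].
  - move=> _ E; have := base_adj j c; rewrite E xv_nadj.
    by case: c E => [[|c] ?] /= E; [case: (ov_xv i' j) | move/(_ isT)].
  (* A common base is either the outside vertex or a leaf, and a leaf has at most one neighbour
     outside [D]. *)
  move=> kE bE; have E : j = j'.
    have [c0 | c0] := eqVneq (val c) 0.
      have c'0 : val c' = 0.
        by move: kE; rewrite /= c0; case: c' {bE} => [[|[|[|[|[|//]]]]] ?].
      by move: bE; rewrite /= c0 c'0 /= => /enum_val_inj.
    have c'0 : val c' != 0.
      by apply: contraNneq c0 => c'0; move: kE; rewrite /= c'0;
        case: c {bE} => [[|[|[|[|[|//]]]]] ?].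
    have := base_adj j' c' c'0; rewrite -bE => o'b.
    have bX := base_X (inr (j, c)); rewrite /= in bX.
    apply: enum_val_inj; apply: outside_nbr_uniq (base_adj j c c0) o'b => //.
    by move: c0 bX; case: c {kE bE} => [[|[|[|[|[|//]]]]] ?].
  subst j'; congr (inr (j, _)); apply: val_inj; move: kE bE => /=.
  have pqF : p j = q j -> False by move/eqP; apply/negP/pqneq.
  by case: c c' => [[|[|[|[|[|//]]]]] ?] [[|[|[|[|[|//]]]]] ?] //= _ E;
    case: pqF.
have g_surj z : exists u, g u = z.
  have ov_surj o : o \notin D -> exists j, ov j = o.
    move=> oD; have oC : o \in ~: D by rewrite inE.
    by exists (enum_rank_in oC o); apply: enum_rankK_in.
  have X_surj x : x \in X -> (exists i, x = xv i) \/ (exists j, x = p j \/ x = q j).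
    move=> xX; have [xK | xK] := boolP (x \in K2_reps).
      by left; exists (enum_rank_in xK x); rewrite /xv enum_rankK_in.
    right; move: xK; rewrite inE xX => /forall_inPn[o]; rewrite inE negbK.
    move=> /ov_surj[j <-]; rewrite ovN ?leaf_reps_D // => H'.
    by exists j; case/orP: H' => /eqP; [left | right].
  have [zD | /ov_surj[j <-]] := boolP (z \in D); last first.
    by exists (inr (j, @Ordinal 5 0 isT)).
  case: (leaf_or_mate_of_leaf zD) => [zX | [x xX ->]].
    case: (X_surj z zX) => [[i ->] | [j [] ->]].
    - by exists (inl (i, @Ordinal 2 0 isT)).
    - by exists (inr (j, @Ordinal 5 1 isT)).
    - by exists (inr (j, @Ordinal 5 4 isT)).
  case: (X_surj x xX) => [[i ->] | [j [] ->]].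
  - by exists (inl (i, @Ordinal 2 1 isT)).
  - by exists (inr (j, @Ordinal 5 2 isT)).
  - by exists (inr (j, @Ordinal 5 3 isT)).
have [f fK] := fin_all_exists g_surj.
exists f; split; first by exists g => // u; apply: g_inj; rewrite fK.
by move=> x y; rewrite adj_blocks -(mem_map g_inj) -adj_g !fK.
Qed.

End Extremal.

(** * Invariance of both parameters under isomorphism *)

Section Isomorphism.

Lemma max_minset_imset (T1 T2 : finType) (P1 : pred {set T1}) (P2 : pred {set T2})
    (f : T1 -> T2) :
  bijective f -> (forall A : {set T1}, P2 (f @: A) = P1 A) ->
  \max_(A | minset P1 A) #|A| = \max_(A | minset P2 A) #|A|.
Proof.
move=> [g fK gK] Pf; have f_inj := can_inj fK.
have imK (A : {set T2}) : f @: (g @: A) = A.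
  by rewrite -imset_comp (eq_imset _ gK) imset_id.
rewrite (reindex (fun A : {set T1} => f @: A)) /=; last first.
  exists (fun A : {set T2} => g @: A) => A _ //.
  by rewrite -imset_comp (eq_imset _ fK) imset_id.
apply: eq_big => [A | A _]; last by rewrite card_imset.
apply/minsetP/minsetP => -[PA minA]; rewrite ?Pf in PA *; split=> // C PC CA.
  have <- : g @: C = A; last by rewrite imK.
  apply: minA; first by rewrite -Pf imK.
  by apply/subsetP => _ /imsetP[y /(subsetP CA)/imsetP[x xA ->] ->]; rewrite fK.
by apply: (imset_inj f_inj); apply: minA; rewrite ?Pf // imsetS.
Qed.

Variables (G H : sgraph) (f : G -> H).
Hypothesis f_bij : bijective f.
Hypothesis f_adj : forall x y : G, adj (f x) (f y) = adj x y.

Lemma dominating_imset (A : {set G}) : dominating (f @: A) = dominating A.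
Proof.
have f_inj := bij_inj f_bij; have [g fK gK] := f_bij.
apply/dominatingP/dominatingP => domA x.
  have [_ /imsetP[y yA ->]] := domA (f x).
  by exists y => //; rewrite /dominates -(inj_eq f_inj) -f_adj.
have [y yA xy] := domA (g x); exists (f y); first exact: imset_f.
by rewrite -(gK x) /dominates (inj_eq f_inj) f_adj.
Qed.

Lemma paired_dominating_imset (A : {set G}) :
  paired_dominating (f @: A) = paired_dominating A.
Proof.
have f_inj := bij_inj f_bij; have [g fK gK] := f_bij.
apply/paired_dominatingP/paired_dominatingP; rewrite dominating_imset;
  move=> -[domA [mu muA]]; split=> //.
  exists (fun x => g (mu (f x))) => x xA; have [mA fmu muK] := muA _ (imset_f f xA).
  by rewrite -(mem_imset _ _ f_inj) -f_adj !gK muK fK.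
exists (fun y => f (mu (g y))) => _ /imsetP[x xA ->]; have [mA xmu muK] := muA _ xA.
by rewrite !fK muK f_adj imset_f.
Qed.

Lemma Gamma_isomorphic : Gamma G = Gamma H.
Proof. exact: max_minset_imset f_bij dominating_imset. Qed.

Lemma Gamma_pr_isomorphic : Gamma_pr G = Gamma_pr H.
Proof. exact: max_minset_imset f_bij paired_dominating_imset. Qed.

End Isomorphism.

(** * Values of both parameters on disjoint unions of edges and 5-cycles *)

Section Blocks.
Variables m1 m2 : nat.
Local Notation H := (blocks m1 m2).
Implicit Types (i : 'I_m1) (j : 'I_m2) (A D : {set H}).

(** Indexing by natural numbers lets neighbours be computed by arithmetic; [inord] is faithful only
    below the block size. *)
Definition edge_vertex i (k : nat) : H := inl (i, inord k : 'I_2).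
Definition pentagon_vertex j (k : nat) : H := inr (j, inord k : 'I_5).

Local Notation e := edge_vertex.
Local Notation v := pentagon_vertex.

Lemma edge_vertexE i (a : 'I_2) : inl (i, a) = e i (val a).
Proof. by rewrite /e inord_val. Qed.

Lemma pentagon_vertexE j (c : 'I_5) : inr (j, c) = v j (val c).
Proof. by rewrite /v inord_val. Qed.

Lemma edge_vertex_inj i : {in gtn 2 &, injective (e i)}.
Proof. by move=> k l k2 l2 [/(congr1 val)]; rewrite /= !inordK. Qed.

Lemma pentagon_vertex_inj j : {in gtn 5 &, injective (v j)}.
Proof. by move=> k l k5 l5 [/(congr1 val)]; rewrite /= !inordK. Qed.

Lemma adj_edge i k w : k < 2 -> adj (e i k) w = (w == e i (1 - k)).
Proof.
move=> k2; rewrite adj_blocks inE; congr (_ == inl (i, _)); apply: val_inj.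
by rewrite /= !inordK //; lia.
Qed.

Lemma adj_pentagon j k w : k < 5 ->
  adj (v j k) w = (w == v j (k.+1 %% 5)) || (w == v j ((k + 4) %% 5)).
Proof.
move=> k5; rewrite adj_blocks !inE; congr (_ || _).
  congr (_ == inr (j, _)); apply: val_inj.
  by rewrite /= !inordK ?ltn_pmod.
congr (_ == inr (j, _)); apply: val_inj.
by rewrite /= !inordK ?ltn_pmod // addnS.
Qed.

Lemma block_card A :
  #|A| = \sum_(i < m1) ((e i 0 \in A) + (e i 1 \in A)) +
         \sum_(j < m2) ((v j 0 \in A) + (v j 1 \in A) + (v j 2 \in A) +
                        (v j 3 \in A) + (v j 4 \in A)).
Proof.
rewrite -sum1_card big_mkcond big_sumType /=; congr (_ + _).
  transitivity (\sum_i \sum_(a < 2) (e i a \in A)).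
    rewrite pair_bigA; apply: eq_bigr => -[i a] _ /=.
    by rewrite edge_vertexE; case: ifP.
  by apply: eq_bigr => i _; rewrite !big_ord_recl big_ord0 addn0.
transitivity (\sum_j \sum_(c < 5) (v j c \in A)).
  rewrite pair_bigA; apply: eq_bigr => -[j c] _ /=.
  by rewrite pentagon_vertexE; case: ifP.
by apply: eq_bigr => j _; rewrite !big_ord_recl big_ord0 addn0 !addnA.
Qed.

Lemma block_card_le A s t :
  (forall i, (e i 0 \in A) + (e i 1 \in A) <= s) ->
  (forall j, (v j 0 \in A) + (v j 1 \in A) + (v j 2 \in A) +
             (v j 3 \in A) + (v j 4 \in A) <= t) ->
  #|A| <= s * m1 + t * m2.
Proof.
move=> As At; rewrite block_card leq_add //.
  apply: (@leq_trans (\sum_(i < m1) s)); first by apply: leq_sum => i _.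
  by rewrite sum_nat_const card_ord mulnC.
apply: (@leq_trans (\sum_(j < m2) t)); first by apply: leq_sum => j _.
by rewrite sum_nat_const card_ord mulnC.
Qed.

(** The two ends dominate the same vertices, so together neither has a private neighbour. *)
Lemma edge_minimal_dominating D i :
  minset (@dominating H) D -> (e i 0 \in D) + (e i 1 \in D) <= 1.
Proof.
move=> minD; case: (boolP (e i 0 \in D)) => //= D0; case: (boolP (e i 1 \in D)) => //= D1.
have [p p0 Hp] := minimal_dominating_private minD D0.
suff /(Hp _ D1)/edge_vertex_inj : dominates p (e i 1) by move/(_ isT isT).
by move: p0; rewrite (dominatesC p (e i 0)) (dominatesC p (e i 1)) /dominates !adj_edge //=
  => /orP[/eqP<- | /eqP ->]; rewrite eqxx ?orbT.
Qed.

Lemma pentagon_minimal_dominating D j :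
  minset (@dominating H) D ->
  (v j 0 \in D) + (v j 1 \in D) + (v j 2 \in D) + (v j 3 \in D) + (v j 4 \in D) <= 2.
Proof.
move=> minD; pose b k := v j k \in D.
(* The private neighbour of vertex [k] is itself, its successor or its predecessor; [k + 4] and
   [k + 3] stand for [k - 1] and [k - 2] modulo 5. *)
have priv k : k < 5 -> b k ->
  [|| ~~ b (k.+1 %% 5) && ~~ b ((k + 4) %% 5),
      ~~ b (k.+1 %% 5) && ~~ b (k.+2 %% 5)
    | ~~ b ((k + 4) %% 5) && ~~ b ((k + 3) %% 5)].
  move=> k5 bk; have [p pk Hp] := minimal_dominating_private minD bk.
  have Hb l : l < 5 -> l != k -> dominates (v j l) p -> ~~ b l.
    move=> l5 lk; rewrite dominatesC => pl; apply: contra lk => bl.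
    by have /pentagon_vertex_inj -> := Hp _ bl pl.
  have domE l m : l < 5 -> (m == l) || (m == l.+1 %% 5) || (m == (l + 4) %% 5) ->
      dominates (v j l) (v j m).
    by move=> l5; rewrite /dominates adj_pentagon //
      => /orP[/orP[] | ] /eqP ->; rewrite eqxx ?orbT.
  move: pk; rewrite dominatesC /dominates adj_pentagon // => /or3P[] /eqP E; subst p.
  - by apply/or3P/Or31; rewrite !Hb // ?domE //; lia.
  - by apply/or3P/Or32; rewrite !Hb // ?domE //; lia.
  - by apply/or3P/Or33; rewrite !Hb // ?domE //; lia.
move: (priv 0 isT) (priv 1 isT) (priv 2 isT) (priv 3 isT) (priv 4 isT).
rewrite /= -!/(b _); by case: (b 0); case: (b 1); case: (b 2); case: (b 3); case: (b 4) => //= *; lia.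
Qed.

Lemma Gamma_blocks : Gamma H = m1 + 2 * m2.
Proof.
apply/eqP; rewrite eqn_leq; apply/andP; split.
  apply/bigmax_leqP => D minD; rewrite -[X in _ <= X + _]mul1n; apply: block_card_le => [i | j].
    exact: edge_minimal_dominating.
  exact: pentagon_minimal_dominating.
pose I : {set H} := [set u | match u with
  | inl (i, a) => val a == 0
  | inr (j, c) => (val c == 1) || (val c == 3)
  end].
have <- : #|I| = m1 + 2 * m2.
  rewrite block_card /I; under eq_bigr do rewrite !inE /= !inordK //.
  rewrite sum_nat_const card_ord; congr (_ + _); first by rewrite muln1.
  under eq_bigr do rewrite !inE /= !inordK //.
  by rewrite sum_nat_const card_ord mulnC.
apply/independent_card_Gamma/independentP => u w.
rewrite adj_blocks !inE.
case: u => [[i a]|[j c]]; case: w => [[i' a']|[j' c']] //=.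
  by move=> /eqP a0 /eqP a'0; rewrite inE; apply/eqP => -[_ E]; move: a'0; rewrite E /= a0.
move=> cI c'I; rewrite !inE; apply/norP; split; apply/eqP => -[_ E]; move: cI c'I;
  by rewrite {}E; case: c => [[|[|[|[|[|//]]]]] ?].
Qed.

(** Matched vertices lie in the same block, and five vertices cannot be paired off. *)
Lemma pentagon_matching D mu j : matching_on mu D ->
  (v j 0 \in D) + (v j 1 \in D) + (v j 2 \in D) + (v j 3 \in D) + (v j 4 \in D) <= 4.
Proof.
move=> muD; have nbr k : k < 5 -> v j k \in D ->
    (mu (v j k) = v j (k.+1 %% 5) \/ mu (v j k) = v j ((k + 4) %% 5))
    /\ mu (mu (v j k)) = v j k.
  move=> k5 /muD[_ + ->]; rewrite adj_pentagon //.
  by case/orP => /eqP; auto.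
have neq k l : k < 5 -> l < 5 -> k != l -> v j k <> v j l.
  by move=> k5 l5 kl /pentagon_vertex_inj; move/(_ k5 l5)/eqP; apply/negP.
case D0: (v j 0 \in D); case D1: (v j 1 \in D); case D2: (v j 2 \in D);
  case D3: (v j 3 \in D); case D4: (v j 4 \in D) => //; exfalso.
have := neq 0 2 isT isT isT; have := neq 1 3 isT isT isT.
have := neq 2 4 isT isT isT; have := neq 0 3 isT isT isT.
have := neq 1 4 isT isT isT.
(* The type ascriptions evaluate the residues modulo 5 by conversion. *)
have [E0 F0] : (_ = v j 1 \/ _ = v j 4) /\ _ := nbr 0 isT D0.
have [E1 F1] : (_ = v j 2 \/ _ = v j 0) /\ _ := nbr 1 isT D1.
have [E2 F2] : (_ = v j 3 \/ _ = v j 1) /\ _ := nbr 2 isT D2.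
have [E3 F3] : (_ = v j 4 \/ _ = v j 2) /\ _ := nbr 3 isT D3.
have [E4 F4] : (_ = v j 0 \/ _ = v j 3) /\ _ := nbr 4 isT D4.
by case: E0 => ?; case: E1 => ?; case: E2 => ?; case: E3 => ?; case: E4 => ? *; congruence.
Qed.

Lemma Gamma_pr_blocks : Gamma_pr H = 2 * m1 + 4 * m2.
Proof.
apply/eqP; rewrite eqn_leq; apply/andP; split.
  apply/bigmax_leqP => D /minsetP[/paired_dominatingP[_ [mu muD]] _].
  apply: block_card_le => [i | j]; last exact: pentagon_matching muD.
  by case: (_ \in _); case: (_ \in _).
(* All vertices except vertex 0 of each 5-cycle, whose remaining path is matched as 1-2 and 3-4. *)
pose D : {set H} := [set u | if u is inr (j, c) then val c != 0 else true].
have <- : #|D| = 2 * m1 + 4 * m2.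
  rewrite block_card /D; under eq_bigr do rewrite !inE /=.
  rewrite sum_nat_const card_ord mulnC; congr (_ + _).
  under eq_bigr do rewrite !inE /= !inordK //.
  by rewrite sum_nat_const card_ord mulnC.
have eD i k : e i k \in D by rewrite inE.
have vD j k : k < 5 -> v j k \in D = (k != 0) by move=> k5; rewrite inE /= inordK.
apply: (leq_bigmax_cond (F := fun D : {set H} => #|D|)); apply/minsetP; split.
  apply/paired_dominatingP; split.
    apply/dominatingP => -[[i a]|[j c]].
      by exists (inl (i, a)); rewrite ?inE // /dominates eqxx.
    case: (eqVneq (val c) 0) => [c0 | c0].
      by exists (v j 1); rewrite ?vD // pentagon_vertexE c0 /dominates adj_pentagon // eqxx !orbT.
    by exists (inr (j, c)); rewrite ?inE // /dominates eqxx.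
  pose mu (u : H) : H := match u with
    | inl (i, a) => e i (1 - a)
    | inr (j, c) => v j (nth 0 [:: 0; 2; 1; 4; 3] c)
    end.
  exists mu => -[[i a]|[j c]].
    move=> _; rewrite eD edge_vertexE adj_edge ?ltn_ord // /mu /= !inordK ?ltn_ord ?eqxx; [|lia..].
    by split=> //; congr (e i _); have := ltn_ord a; lia.
  rewrite pentagon_vertexE vD ?ltn_ord // adj_pentagon ?ltn_ord // /mu /= !inordK ?ltn_ord //;
    case: c => [[|[|[|[|[|//]]]]] ?] //= _; by rewrite ?vD ?eqxx ?orbT.
move=> B /paired_dominatingP[/dominatingP domB [nu nuB]] BD; apply/eqP.
rewrite eqEsubset BD; apply/subsetP => -[[i a] _ | [j c]].
  have eB k : k < 2 -> e i k \in B -> e i (1 - k) \in B.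
    by move=> k2 /nuB[]; rewrite adj_edge // => + /eqP <-.
  have [w wB] := domB (inl (i, a)); rewrite edge_vertexE /dominates adj_edge ?ltn_ord //.
  case/orP => /eqP E; first by rewrite E.
  have aK : 1 - (1 - a) = a by have := ltn_ord a; lia.
  by rewrite -[val a]aK; apply: eB; [lia | rewrite -E].
have nbr k : k < 5 -> v j k \in B -> [/\ nu (v j k) \in B, nu (nu (v j k)) = v j k &
    nu (v j k) = v j (k.+1 %% 5) \/ nu (v j k) = v j ((k + 4) %% 5)].
  move=> k5 /nuB[+ + ->]; rewrite adj_pentagon // => -> /orP E; split=> //.
  by case: E => /eqP; auto.
have v0B : v j 0 \notin B by apply/negP => /(subsetP BD); rewrite vD.
have neq k l : k < 5 -> l < 5 -> k != l -> v j k <> v j l.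
  by move=> k5 l5 kl /pentagon_vertex_inj; move/(_ k5 l5)/eqP; apply/negP.
have dom k : k < 5 -> [\/ v j k \in B, v j (k.+1 %% 5) \in B | v j ((k + 4) %% 5) \in B].
  move=> k5; have [w wB] := domB (v j k); rewrite /dominates adj_pentagon //.
  by case/or3P => /eqP E; [apply: Or31; rewrite E | apply: Or32; rewrite -E | apply: Or33; rewrite -E].
have nbr1 : v j 1 \in B -> v j 2 \in B /\ nu (v j 2) = v j 1.
  move=> v1B; have [nB nK [E | E]] : [/\ _, _ & _ = v j 2 \/ _ = v j 0] := nbr 1 isT v1B.
    by rewrite -E.
  by rewrite -E nB in v0B.
have nbr4 : v j 4 \in B -> v j 3 \in B /\ nu (v j 3) = v j 4.
  move=> v4B; have [nB nK [E | E]] : [/\ _, _ & _ = v j 0 \/ _ = v j 3] := nbr 4 isT v4B.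
    by rewrite -E nB in v0B.
  by rewrite -E.
(* Vertex 0 is dominated from 1 or 4. If 1 is in [B], its mate is 2, so 3 can be matched only to 4;
   as 4 must be dominated, 4 is in [B]. The other case is symmetric. *)
have [v1B v4B] : v j 1 \in B /\ v j 4 \in B.
  have [F | v1B | v4B] : [\/ _, v j 1 \in B | v j 4 \in B] := dom 0 isT.
  - by rewrite F in v0B.
  - split=> //; have [v2B E2] := nbr1 v1B.
    have [// | F | v3B] : [\/ _, v j 0 \in B | v j 3 \in B] := dom 4 isT.
      by rewrite F in v0B.
    have [nB nK [E | E]] : [/\ _, _ & _ = v j 4 \/ _ = v j 2] := nbr 3 isT v3B.
      by rewrite -E.
    by case: (neq 1 3); rewrite // -E2 -nK E.
  - split=> //; have [v3B E3] := nbr4 v4B.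
    have [// | v2B | F] : [\/ _, v j 2 \in B | v j 0 \in B] := dom 1 isT; last first.
      by rewrite F in v0B.
    have [nB nK [E | E]] : [/\ _, _ & _ = v j 3 \/ _ = v j 1] := nbr 2 isT v2B.
      by case: (neq 4 2); rewrite // -E3 -nK E.
    by rewrite -E.
have [v2B _] := nbr1 v1B; have [v3B _] := nbr4 v4B.
rewrite pentagon_vertexE vD ?ltn_ord //.
by case: c => [[|[|[|[|[|//]]]]] ?].
Qed.
End Blocks.

Theorem theorem20 (G : sgraph) (G_nonempty : 0 < #|G|)
    (G_cactus : cactus G) (G_C3_free : triangle_free G) :
  Gamma_pr G = 2 * Gamma G <->
  exists m1 m2 : nat,
    1 <= m1 + m2 /\
    isomorphic G (disjoint_union (copies m1 (complete_graph 2))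
                                 (copies m2 (cycle_graph 5))).
Proof.
split=> [eqG | [m1 [m2 [_ [f [f_bij f_adj]]]]]]; last first.
  rewrite (Gamma_isomorphic f_bij f_adj) (Gamma_pr_isomorphic f_bij f_adj).
  by rewrite Gamma_blocks Gamma_pr_blocks; lia.
have /card_gt0P[x _] := G_nonempty.
have G_gt0 : 0 < Gamma G.
  rewrite -(cards1 x); apply/independent_card_Gamma/independentP.
  by move=> y z /set1P-> /set1P->; rewrite adj_irrefl.
have [D D_min D_card] : exists2 D, minset (@paired_dominating G) D & #|D| = 2 * Gamma G.
  rewrite -eqG; case: (pickP (minset (@paired_dominating G))) => [D0 minD0 | none].
    have := bigmax_eq_arg D0 (F := fun D : {set G} => #|D|) minD0.
    by case: arg_maxnP => // D minD _ /esym; exists D.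
  (* Without a minimal paired dominating set, [Gamma_pr G] is the empty maximum 0, while [Gamma G]
     is positive. *)
  by move: G_gt0; rewrite -(ltn_pmul2l (isT : 0 < 2)) -eqG /Gamma_pr big_pred0.
have /minsetP[/paired_dominatingP[_ [mu mu_D]] _] := D_min.
have [m1 [m2 isoG]] := extremal_isomorphic G_cactus G_C3_free D_min mu_D D_card.
exists m1, m2; split=> //; case: isoG => f _.
(* The image of a vertex carries a block index, so [m1] or [m2] is positive. *)
by case: (f x) => -[[k k_lt] _]; lia.
Qed.
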